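(* Let $u_{n+4}=\omega(n,u_n,u_{n+1},u_{n+2},u_{n+3})$ be a fourth-order difference equation, with $\omega$ differentiable in $u_n,\dots,u_{n+3}$ and $\partial\omega/\partial u_n\neq 0$. Let $\phi=\phi(n,u_n,u_{n+1},u_{n+2},u_{n+3})$ be a first integral of this equation, differentiable in $u_n,\dots,u_{n+3}$, and put $P_i=\dfrac{\partial \phi}{\partial u_{n+i}}$ for $i=0,1,2,3$. Then $$P_0=\frac{\partial\omega}{\partial u_n}\,S(P_3),\qquad P_1=S(P_0)+\frac{\partial\omega}{\partial u_{n+1}}\,S(P_3),$$ $$P_2=S(P_1)+\frac{\partial\omega}{\partial u_{n+2}}\,S(P_3),\qquad P_3=S(P_2)+\frac{\partial\omega}{\partial u_{n+3}}\,S(P_3),$$ and consequently $P_3$ satisfies $$S^3\!\left(\frac{\partial\omega}{\partial u_n}\right)S^4(P_3)+S^2\!\left(\frac{\partial\omega}{\partial u_{n+1}}\right)S^3(P_3)+S\!\left(\frac{\partial\omega}{\partial u_{n+2}}\right)S^2(P_3)+\frac{\partial\omega}{\partial u_{n+3}}\,S(P_3)-P_3=0 .$$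
   Context: Here $n$ is an integer variable and, for each $n$, the quantities $u_n,u_{n+1},u_{n+2},u_{n+3}$ are treated as independent continuous variables. The shift operator $S$ is $S:n\mapsto n+1$. It acts on functions on solutions of the equation: for $f=f(n,u_n,u_{n+1},u_{n+2},u_{n+3})$, $$S(f)=f\big(n+1,u_{n+1},u_{n+2},u_{n+3},\omega(n,u_n,u_{n+1},u_{n+2},u_{n+3})\big),$$ and $S^k$ is the $k$-fold iterate of $S$. A first integral of the equation is a function $\phi(n,u_n,u_{n+1},u_{n+2},u_{n+3})$ that is constant on solutions, i.e. $S(\phi)=\phi$, which means $$\phi\big(n+1,u_{n+1},u_{n+2},u_{n+3},\omega(n,u_n,u_{n+1},u_{n+2},u_{n+3})\big)=\phi(n,u_n,u_{n+1},u_{n+2},u_{n+3}).$$ *)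

(* Defs.v *)
From HB Require Import structures.
From mathcomp Require Import all_boot all_order all_algebra.
From mathcomp Require Import all_classical all_reals all_analysis.

Set Implicit Arguments.
Unset Strict Implicit.
Unset Printing Implicit Defensive.

Import Order.TTheory GRing.Theory Num.Theory.
Import numFieldNormedType.Exports.

Local Open Scope classical_set_scope.
Local Open Scope ring_scope.

(* A function f(n, u_n, u_{n+1}, u_{n+2}, u_{n+3}) is represented as
   f : int -> 'rV[R]_4 -> T, the coordinate x 0 i of the vector standing for
   u_{n+i}; 'I_4 = 'Z_4 provides the index numerals 0, 1, 2, 3.
   Since omega and phi need not be defined everywhere (they are typically
   rational), they are considered on domains D n of R^4, and total functions
   are only constrained there. *)

(* (u_n, u_{n+1}, u_{n+2}, u_{n+3}) |->
   (u_{n+1}, u_{n+2}, u_{n+3}, omega(n, u_n, u_{n+1}, u_{n+2}, u_{n+3})) *)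
Definition next_state (R : realType) (omega : int -> 'rV[R]_4 -> R)
    (n : int) (x : 'rV[R]_4) : 'rV[R]_4 :=
  \row_(i < 4) if i == ord_max then omega n x else x 0 (i + 1).

(* T is R for functions; with T := Prop the same operator acts on families of
   domains, so that iter k (shift_op omega) D n x says that the k-th iterate of
   the point (n, x) lies in the domain. *)
Definition shift_op (R : realType) (T : Type) (omega : int -> 'rV[R]_4 -> R)
    (f : int -> 'rV[R]_4 -> T) : int -> 'rV[R]_4 -> T :=
  fun n x => f (n + 1) (next_state omega n x).

Definition partial_u (R : realType) (i : 'I_4) (f : int -> 'rV[R]_4 -> R)
    : int -> 'rV[R]_4 -> R :=
  fun n x => 'D_(delta_mx 0 i) (f n) x.

Definition first_integral (R : realType) (D : int -> set 'rV[R]_4)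
    (omega phi : int -> 'rV[R]_4 -> R) : Prop :=
  forall (n : int) (x : 'rV[R]_4), D n x -> shift_op omega D n x ->
    shift_op omega phi n x = phi n x.

(* Main.v *)
Require Import Defs.
From HB Require Import structures.
From mathcomp Require Import all_boot all_order all_algebra.
From mathcomp Require Import all_classical all_reals all_analysis.

Import Order.TTheory GRing.Theory Num.Theory.
Import numFieldNormedType.Exports.

Local Open Scope classical_set_scope.
Local Open Scope ring_scope.

Set Implicit Arguments.
Unset Strict Implicit.

(** A first integral satisfies [phi (n+1) (next_state omega n y) = phi n y] for
    every [y] in a neighbourhood of [x]: both domain conditions are open, since
    [next_state omega n] is continuous at [x].  The two sides therefore have the
    same partial derivatives at [x], and the chain rule evaluates those of the
    left-hand side.  As [next_state omega n] is a linear shift of the coordinates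
    plus [omega n] in the last slot, it moves [u_{n+i}] into slot [i - 1] (or
    drops it if [i = 0]) and makes slot 3 vary at the rate of the [i]-th partial
    derivative of [omega].  This is [partial_first_integral], which contains the
    four relations.

    The equation for [P_3] follows by eliminating [P_2], [P_1] and [P_0] in
    turn: the relation for [P_{3-k}] is used at the [k]-th iterate of
    [(n, x)], whose domain conditions are those for the iterates [k] and
    [k + 1]. *)

(** A linear map is a finite combination of coordinates with constant vector
    coefficients, namely the images of the canonical basis. *)
Lemma differentiable_linear_rV (R : realType) (m : nat) (W : normedModType R)
    (f : {linear 'rV[R]_m -> W}) (x : 'rV[R]_m) : differentiable f x.
Proof.
have -> : (f : 'rV[R]_m -> W)
    = \sum_(j < m) (fun y : 'rV[R]_m => y 0 j *: f (delta_mx 0 j)).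
  apply/funext => y; rewrite fct_sumE {1}(row_sum_delta y) linear_sum.
  by apply: eq_bigr => j _; rewrite linearZ.
apply: differentiable_sum => j.
exact/differentiableZl/differentiable_coord.
Qed.

Definition shift_coords (R : realType) (x : 'rV[R]_4) : 'rV[R]_4 :=
  \row_(i < 4) if i == ord_max then 0 else x 0 (i + 1).

Lemma shift_coords_is_linear (R : realType) : linear (@shift_coords R).
Proof.
move=> a x y; apply/rowP => i; rewrite !mxE.
by case: ifP => _; rewrite ?mulr0 ?addr0.
Qed.

HB.instance Definition _ (R : realType) :=
  GRing.isLinear.Build R 'rV[R]_4 'rV[R]_4 _ (@shift_coords R)
    (@shift_coords_is_linear R).

Lemma shift_coords_delta (R : realType) (i : 'I_4) :
  shift_coords (delta_mx 0 i) =
    if i == 0 then 0 else delta_mx 0 (i - 1) :> 'rV[R]_4.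
Proof.
apply/rowP => j; rewrite !mxE eqxx /=.
by case: i => [[|[|[|[|//]]]] ?]; case: j => [[|[|[|[|//]]]] ?]; rewrite !mxE.
Qed.

Lemma next_stateE (R : realType) (omega : int -> 'rV[R]_4 -> R) (n : int) :
  next_state omega n
  = @shift_coords R + (fun x => omega n x *: delta_mx 0 ord_max).
Proof.
apply/funext => x; apply/rowP => i; rewrite !mxE /=.
by case: ifP => _; rewrite ?mulr1 ?mulr0 ?add0r ?addr0.
Qed.

Lemma differentiable_next_state (R : realType)
    (omega : int -> 'rV[R]_4 -> R) (n : int) (x : 'rV[R]_4) :
  differentiable (omega n) x -> differentiable (next_state omega n) x.
Proof.
move=> omega_diff.
rewrite next_stateE; apply: differentiableD.
  exact: differentiable_linear_rV.
exact: differentiableZl.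
Qed.

Lemma diff_next_state_delta (R : realType) (omega : int -> 'rV[R]_4 -> R)
    (n : int) (x : 'rV[R]_4) (i : 'I_4) :
  differentiable (omega n) x ->
  'd (next_state omega n) x (delta_mx 0 i)
  = (if i == 0 then 0 else delta_mx 0 (i - 1))
    + partial_u i omega n x *: delta_mx 0 ord_max.
Proof.
move=> omega_diff.
have shift_diff y := @differentiable_linear_rV R 4 _ (@shift_coords R) y.
have dshift : 'd (@shift_coords R) x = @shift_coords R :> (_ -> _).
  by apply: diff_lin => y; exact: differentiable_continuous.
have -> : 'd (next_state omega n) x
    = @shift_coords R \+ (fun v => 'd (omega n) x v *: delta_mx 0 ord_max)
    :> (_ -> _).
  rewrite next_stateE.
  apply: etrans (diffD (shift_diff x) (differentiableZl _ omega_diff)) _.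
  exact: (f_equal2 (fun f g : 'rV[R]_4 -> 'rV[R]_4 => f \+ g) dshift
    (diffZl _ omega_diff)).
by rewrite -shift_coords_delta /partial_u deriveE.
Qed.

(** Openness of both domains and continuity of [next_state] spread the
    invariance of [phi] to a whole neighbourhood of [x], which is what makes it
    possible to differentiate it. *)
Lemma near_first_integral (R : realType) (D : int -> set 'rV[R]_4)
    (omega phi : int -> 'rV[R]_4 -> R) (n : int) (x : 'rV[R]_4) :
  (forall n, open (D n)) -> first_integral D omega phi ->
  differentiable (omega n) x -> D n x -> shift_op omega D n x ->
  \forall y \near x, shift_op omega phi n y = phi n y.
Proof.
move=> D_open phiI omega_diff Dx Dsx.
have next_cont := differentiable_continuous (differentiable_next_state omega_diff).
have nearD : \forall y \near x, D n y by exact: open_nbhs_nbhs.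
have nearSD : \forall y \near x, shift_op omega D n y.
  by apply: next_cont; exact: open_nbhs_nbhs.
by near=> y; apply: phiI; near: y.
Unshelve. all: by end_near. Qed.

(** The chain rule for [phi (n+1) \o next_state omega n]; the case [i = 0] has no
    shifted term because [u_n] is dropped from the next state. *)
Lemma partial_first_integral (R : realType) (D : int -> set 'rV[R]_4)
    (omega phi : int -> 'rV[R]_4 -> R) (n : int) (x : 'rV[R]_4) (i : 'I_4) :
  (forall n, open (D n)) -> first_integral D omega phi ->
  (forall n x, D n x -> differentiable (phi n) x) ->
  differentiable (omega n) x -> D n x -> shift_op omega D n x ->
  partial_u i phi n x
  = (if i == 0 then 0 else shift_op omega (partial_u (i - 1) phi) n x)
    + partial_u i omega n x * shift_op omega (partial_u ord_max phi) n x.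
Proof.
move=> D_open phiI phi_diff omega_diff Dx Dsx.
have phi_diffS : differentiable (phi (n + 1)) (next_state omega n x).
  exact: phi_diff.
have next_diff := differentiable_next_state omega_diff.
have -> : partial_u i phi n x
    = 'D_(delta_mx 0 i) (phi (n + 1) \o next_state omega n) x.
  apply: near_eq_derive.
  apply: filterS (near_first_integral D_open phiI omega_diff Dx Dsx) => y.
  exact: esym.
rewrite deriveE; last exact: differentiable_comp.
rewrite diff_comp //= diff_next_state_delta // linearD linearZ /=.
rewrite /shift_op /partial_u -!deriveE //; congr (_ + _).
by case: ifP => _; rewrite ?derive0.
Qed.

Unset Implicit Arguments.
Set Strict Implicit.

Theorem mainTheorem1 (R : realType) (D : int -> set 'rV[R]_4)
    (omega phi : int -> 'rV[R]_4 -> R)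
    (D_open : forall n : int, open (D n))
    (omega_diff : forall (n : int) (x : 'rV[R]_4), D n x ->
       differentiable (omega n) x)
    (omega_neq0 : forall (n : int) (x : 'rV[R]_4), D n x ->
       partial_u 0 omega n x != 0)
    (phi_diff : forall (n : int) (x : 'rV[R]_4), D n x ->
       differentiable (phi n) x)
    (phi_first_integral : first_integral D omega phi) :
  let S := @shift_op R R omega in
  let P := fun i : 'I_4 => partial_u i phi in
  (forall (n : int) (x : 'rV[R]_4), D n x -> shift_op omega D n x ->
     [/\ P 0 n x = partial_u 0 omega n x * S (P 3) n x,
         P 1 n x = S (P 0) n x + partial_u 1 omega n x * S (P 3) n x,
         P 2 n x = S (P 1) n x + partial_u 2 omega n x * S (P 3) n x
       & P 3 n x = S (P 2) n x + partial_u 3 omega n x * S (P 3) n x]) /\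
  (forall (n : int) (x : 'rV[R]_4),
     (forall k : nat, (k <= 4)%N -> iter k (shift_op omega) D n x) ->
     iter 3 S (partial_u 0 omega) n x * iter 4 S (P 3) n x
     + iter 2 S (partial_u 1 omega) n x * iter 3 S (P 3) n x
     + S (partial_u 2 omega) n x * iter 2 S (P 3) n x
     + partial_u 3 omega n x * S (P 3) n x
     - P 3 n x = 0).
Proof.
move=> S P.
have rels (n : int) (x : 'rV[R]_4) : D n x -> shift_op omega D n x ->
     [/\ P 0 n x = partial_u 0 omega n x * S (P 3) n x,
         P 1 n x = S (P 0) n x + partial_u 1 omega n x * S (P 3) n x,
         P 2 n x = S (P 1) n x + partial_u 2 omega n x * S (P 3) n x
       & P 3 n x = S (P 2) n x + partial_u 3 omega n x * S (P 3) n x].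
  move=> Dx Dsx.
  have rel i := partial_first_integral i D_open phi_first_integral
    phi_diff
    (omega_diff n x Dx) Dx Dsx.
  (* The two sides have the same value but different proofs of the bound 4. *)
  have max3 : ord_max = 3 :> 'I_4 by exact/val_inj.
  have pred1 : 1 - 1 = 0 :> 'I_4 by exact/val_inj.
  have pred2 : 2 - 1 = 1 :> 'I_4 by exact/val_inj.
  have pred3 : 3 - 1 = 2 :> 'I_4 by exact/val_inj.
  split; rewrite /P rel max3 /=.
  - by rewrite add0r.
  - by rewrite pred1.
  - by rewrite pred2.
  - by rewrite pred3.
split=> // n x Dk.
have [_ _ _ P3E] := rels _ _ (Dk 0%N isT) (Dk 1%N isT).
have [_ _ P2E _] := rels _ _ (Dk 1%N isT) (Dk 2%N isT).
have [_ P1E _ _] := rels _ _ (Dk 2%N isT) (Dk 3%N isT).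
have [P0E _ _ _] := rels _ _ (Dk 3%N isT) (Dk 4%N isT).
apply/eqP; rewrite subr_eq0; apply/eqP; rewrite P3E; congr (_ + _).
rewrite [RHS]P2E; congr (_ + _).
rewrite [RHS]P1E; congr (_ + _).
by rewrite [RHS]P0E.
Qed.
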